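(* Let $\alpha=(\alpha_1,\dots,\alpha_\ell)$ and $\beta=(\beta_1,\dots,\beta_\ell)$ be compositions of length $\ell$, and put $\hat\alpha_i=\alpha_i-i$, $\hat\beta_j=\beta_j-j$. Suppose that for every $k$ with $1\le k\le\ell$, the number of indices $i\in\{1,\dots,\ell\}$ such that $|\{j:\hat\beta_j>\hat\alpha_i\}|\ge\ell-k+1$ is at most $k-1$. Then the $H$-basis expansion $\mathfrak{S}_{\alpha/\beta}=\sum_{\sigma\in S_\ell}\operatorname{sgn}(\sigma)\,H_{\hat\alpha_1-\hat\beta_{\sigma(1)}}\cdots H_{\hat\alpha_\ell-\hat\beta_{\sigma(\ell)}}$ contains at least one nonzero term before cancellation, i.e. there exists $\sigma\in S_\ell$ with $\hat\alpha_i-\hat\beta_{\sigma(i)}\ge0$ for all $i$.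
   Context: A composition is a finite sequence of positive integers. $\mathrm{NSym}$ is the free associative algebra over $\mathbb{R}$ generated by noncommuting $H_1,H_2,\dots$ with $H_0=1$ and $H_a=0$ for $a<0$. The skew immaculate function $\mathfrak{S}_{\alpha/\beta}$ is the noncommutative determinant (Laplace expansion from the top row sequentially to the bottom) of the matrix $(H_{(\alpha_i-i)-(\beta_j-j)})_{i,j}$; a term is nonzero before cancellation when all its subscripts are nonnegative. *)

(* Defs.v *)
From HB Require Import structures.
From mathcomp Require Export all_boot all_order all_fingroup all_algebra.
From mathcomp Require Export reals.
From mathcomp Require Export monalg.

Set Implicit Arguments.
Unset Strict Implicit.
Unset Printing Implicit Defensive.

Import GRing.Theory.
Local Open Scope ring_scope.

Definition is_composition (alpha : seq nat) : bool := all (fun a => 0 < a)%N alpha.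

(* The algebra of the free monoid on the letters 0, 1, 2, ...; the letter n
   stands for the generator H_{n+1}. *)
Notation NSym R := {malg R[{fmonom nat}]}.

Definition Hgen (R : realType) (a : int) : NSym R :=
  match a with
  | Posz 0 => 1
  | Posz n.+1 => << fmu n >>
  | Negz _ => 0
  end.

(* The entry alpha_i - i, for the 1-based position i.+1 of the 0-based index i. *)
Definition hat (alpha : seq nat) (i : nat) : int :=
  (nth 0%N alpha i)%:Z - i.+1%:Z.

(* Determinant over a noncommutative ring: Laplace expansion along the top row,
   each top-row entry standing to the left of its minor. *)
Fixpoint ncdet (A : pzRingType) (n : nat) : 'M[A]_n -> A :=
  match n with
  | 0 => fun=> 1
  | m.+1 => fun M => \sum_(j < m.+1)
      (-1) ^+ j * M ord0 j * ncdet (row' ord0 (col' j M))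
  end.

Definition skew_immaculate (R : realType) (l : nat) (alpha beta : seq nat) :
    NSym R :=
  ncdet (\matrix_(i < l, j < l) Hgen R (hat alpha i - hat beta j)).

(* The product is taken in the order i = 0, 1, ..., l - 1. *)
Definition Hterm (R : realType) (l : nat) (alpha beta : seq nat) (s : 'S_l) :
    NSym R :=
  (-1) ^+ s * \prod_(i < l) Hgen R (hat alpha i - hat beta (s i)).

(* Main.v *)
Require Import Defs.
From mathcomp Require Import zify.

Set Implicit Arguments.
Unset Strict Implicit.
Unset Printing Implicit Defensive.

Import Order.TTheory GRing.Theory Num.Theory.
Local Open Scope ring_scope.

(** Write both hat sequences in increasing order and match the k-th smallest
    entry of hat alpha with the k-th smallest entry of hat beta. If the former
    were smaller than the latter for some k, the k + 1 smallest entries of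
    hat alpha (counting k from 0) would all lie below the l - k largest entries
    of hat beta, which the hypothesis forbids. A term of the expansion with
    nonnegative subscripts is, up to sign, a single word of the free monoid,
    hence nonzero. *)

(** Injectivity suffices, both sides having [(n+1)!] elements. Used to split a sum over permutations
    according to the column chosen in the top row. *)
Lemma lift_perm_bij (n : nat) (i : 'I_n.+1) :
  bijective (fun js : 'I_n.+1 * 'S_n => lift_perm i js.1 js.2).
Proof.
apply: inj_card_bij; last by rewrite card_prod !card_Sn card_ord factS.
move=> [j s] [k t] /= eq_st.
have eq_jk : j = k by rewrite -(lift_perm_id i j s) eq_st lift_perm_id.
rewrite -{k}eq_jk in eq_st *; congr (_, _); apply/permP => x.
by apply: (@lift_inj _ j); rewrite -!(lift_perm_lift i) eq_st.
Qed.

(** Expanding from the top row keeps the factors in row order, so the Leibniz formula survives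
    without commutativity. *)
Lemma ncdet_permE (A : pzRingType) (n : nat) (M : 'M[A]_n) :
  ncdet M = \sum_(s : 'S_n) (-1) ^+ s * \prod_(i < n) M i (s i).
Proof.
elim: n => [|n IHn] in M *.
  rewrite (big_pred1 1%g) => [|s].
    by rewrite /= odd_perm1 big_ord0 mulr1.
  by apply/esym/eqP/permP; case.
rewrite (reindex _ (onW_bij _ (lift_perm_bij ord0))) /=.
rewrite -(pair_big predT predT (fun j s =>
  (-1) ^+ lift_perm ord0 j s * \prod_(i < n.+1) M i (lift_perm ord0 j s i))) /=.
apply: eq_bigr => j _; rewrite IHn big_distrr; apply: eq_bigr => s _ /=.
rewrite odd_lift_perm /= signr_addb signr_odd big_ord_recl lift_perm_id.
(* Only the sign of [s] moves past [M ord0 j]; signs are central, so the entries keep their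
   order. *)
rewrite !mulrA -[_ * M ord0 j * _]mulrA commr_sign !mulrA; congr (_ * _).
by apply: eq_bigr => i _; rewrite !mxE lift_perm_lift.
Qed.

Lemma sorting_perm (d : Order.disp_t) (T : orderType d) (n : nat)
    (f : 'I_n -> T) :
  exists p : 'S_n, {homo (fun i => f (p i)) : i j / (i <= j)%N >-> (i <= j)%O}.
Proof.
have /tuple_permP [p def_s] :
  perm_eq (sort <=%O [tuple f i | i < n]) [tuple f i | i < n].
  by rewrite perm_sort.
exists p => i j le_ij.
have fpE (k : 'I_n) : f (p k) = nth (f i) (sort <=%O [tuple f i | i < n]) k.
  by rewrite def_s -tnth_nth !tnth_mktuple.
by rewrite !fpE; apply: le_sorted_leq_nth; rewrite ?inE ?size_sort ?size_tuple
  ?sort_le_sorted.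
Qed.

Lemma dominating_perm (d : Order.disp_t) (T : orderType d) (n : nat)
    (a b : 'I_n -> T) :
  (forall k, (k < n)%N ->
     (#|[set i | (n - k <= #|[set j | (a i < b j)%O]|)%N]| <= k)%N) ->
  exists s : 'S_n, forall i, (b (s i) <= a i)%O.
Proof.
move=> few; have [p bp_homo] := sorting_perm b.
have [q aq_homo] := sorting_perm a.
(* Permutations compose left to right: [i] goes to its rank in [a], then to the index of that rank
   in [b]. *)
exists (q^-1 * p)%g => i; rewrite permM -{2}(permKV q i).
set k := (q^-1)%g i; rewrite leNgt; apply/negP => lt_ab.
have := few k (ltn_ord k); rewrite leqNgt => /negP; apply.
(* [low] runs over ranks [0..k] of [a], [high] over ranks [n-1] down to [k] of [b]. *)
pose low (x : 'I_k.+1) : 'I_n := q (widen_ord (ltn_ord k) x).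
pose high (x : 'I_(n - k)) : 'I_n := p (rev_ord (widen_ord (leq_subr k n) x)).
have low_inj : injective low.
  by move=> x y /perm_inj /(congr1 val) /= /val_inj.
have high_inj : injective high.
  by move=> x y /perm_inj /rev_ord_inj /(congr1 val) /= /val_inj.
rewrite -[k.+1]card_ord -cardsT -(card_imset _ low_inj).
apply/subset_leq_card/subsetP => _ /imsetP [x _ ->]; rewrite inE.
rewrite -[(n - k)%N]card_ord -cardsT -(card_imset _ high_inj).
apply/subset_leq_card/subsetP => _ /imsetP [y _ ->]; rewrite inE.
(* The chain is [a (low x) <= a (q k) < b (p k) <= b (high y)]. *)
apply: le_lt_trans (aq_homo _ k _) (lt_le_trans lt_ab (bp_homo k _ _)) => /=.
  by rewrite -ltnS.
by have := ltn_ord y; have := ltn_ord k; lia.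
Qed.

Lemma Hgen_monomial (R : realType) (a : int) :
  0 <= a -> exists m : {fmonom nat}, Hgen R a = << m >>.
Proof. by case: a => [[|n]|n] // _; [exists mone | exists (fmu n)]. Qed.

Lemma prod_monomial (R : nzRingType) (K : monomType) (I : Type) (r : seq I)
    (F : I -> {malg R[K]}) :
  (forall i, exists m, F i = << m >>) ->
  exists m, \prod_(i <- r) F i = << m >>.
Proof.
move=> monF; apply: (big_ind (fun g : {malg R[K]} => exists m, g = << m >>)).
- by exists mone.
- by move=> _ _ [m1 ->] [m2 ->]; exists (mmul m1 m2);
    rewrite malgM_def fgmulUU mulr1.
- by [].
Qed.

Lemma Hterm_neq0 (R : realType) (l : nat) (alpha beta : seq nat) (s : 'S_l) :
  (forall i : 'I_l, 0 <= hat alpha i - hat beta (s i)) ->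
  Hterm R alpha beta s <> 0.
Proof.
move=> ge0; rewrite /Hterm.
have [m ->] := prod_monomial (index_enum 'I_l)
  (fun i => Hgen_monomial R (ge0 i)).
apply/eqP; rewrite mulr_sign.
by case: (s : bool); rewrite ?oppr_eq0 monalgU_eq0 oner_eq0.
Qed.

Theorem theorem5 (R : realType) (l : nat) (alpha beta : seq nat)
  (alpha_comp : is_composition alpha) (beta_comp : is_composition beta)
  (size_alpha : size alpha = l) (size_beta : size beta = l)
  (few : forall k : nat, (1 <= k <= l)%N ->
    (#|[set i : 'I_l |
         (l - k + 1 <= #|[set j : 'I_l | (hat beta j > hat alpha i)%R]|)%N]|
       <= k - 1)%N) :
  skew_immaculate R l alpha beta = \sum_(s : 'S_l) Hterm R alpha beta s /\
  exists s : 'S_l,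
    Hterm R alpha beta s <> 0 /\
    forall i : 'I_l, 0 <= hat alpha i - hat beta (s i).
Proof.
split.
  rewrite /skew_immaculate ncdet_permE; apply: eq_bigr => s _.
  by rewrite /Hterm; congr (_ * _); apply: eq_bigr => i _; rewrite mxE.
have [s le_s] : exists s : 'S_l, forall i, hat beta (s i) <= hat alpha i.
  apply: (@dominating_perm _ _ _ (hat alpha) (hat beta)) => k lt_kl.
  (* Shift from [k] counted from 1 to [k] counted from 0; [k < l] makes the truncated [l - k.+1 + 1]
     equal to [l - k]. *)
  by have := few k.+1 lt_kl; rewrite subn1 subnS addn1 prednK // subn_gt0.
have ge0_s (i : 'I_l) : 0 <= hat alpha i - hat beta (s i) by rewrite subr_ge0.
by exists s; split => //; apply: Hterm_neq0.
Qed.
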